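(* If there exists a $3$-gon with edges of curvature $\kappa_1,\kappa_2,\kappa_3$, then its shape is unique up to orientation and isometry (that is, any two $3$-gons with edge curvatures $\kappa_1,\kappa_2,\kappa_3$ are congruent by a possibly orientation-reversing isometry of the plane), and the $3$-gon is determined by the triangle of its vertices.
   Context: A $3$-gon is a connected portion (face) of an interior region of a regular bubble complex in $\mathbb{R}^2$ that is bounded by exactly three edges. By regularity, each edge is an arc of a circle or a line segment (constant curvature, signed so that an edge bulging out of the $3$-gon has positive curvature), and each of the three interior angles at its vertices equals $2\pi/3$.
   Formalization: ''Determined by the triangle of its vertices'' is asserted only when both 3-gons run around the vertices in the same sense or all triangle angles are at most 5π/6; otherwise (e.g. collinear vertices, reflected 3-gon) two different 3-gons share the same vertices. *)

(* Defs.v *)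
From HB Require Import structures.
From mathcomp Require Import all_boot all_order all_algebra.
From mathcomp Require Import all_classical all_reals all_analysis.
From mathcomp Require Import ring lra.

Set Implicit Arguments.
Unset Strict Implicit.
Unset Printing Implicit Defensive.

Import Order.TTheory GRing.Theory Num.Theory.
Import numFieldNormedType.Exports.

Local Open Scope classical_set_scope.
Local Open Scope ring_scope.

(* The library norm on R * R is the sup norm; it is used below only through
   the topology and boundedness.  Lengths and angles use [dotp] and [edist]. *)
Definition dotp (R : realType) (u v : R * R) : R := u.1 * v.1 + u.2 * v.2.

Definition edist (R : realType) (p q : R * R) : R :=
  Num.sqrt (dotp (p - q) (p - q)).

Definition isometry (R : realType) (f : R * R -> R * R) : Prop :=
  forall p q, edist (f p) (f q) = edist p q.

Definition frontier (T : topologicalType) (A : set T) : set T :=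
  closure A `\` interior A.

Definition unitv (R : realType) (a : R) : R * R := (cos a, sin a).

(* The point at arc length [s] on the curve that starts at [p] in the direction
   [unitv a] and whose tangent turns counterclockwise at the constant rate [k]:
   a straight line if k = 0, a circle of radius 1 / `|k| otherwise. *)
Definition cc_point (R : realType) (p : R * R) (a k s : R) : R * R :=
  if k == 0 then (p.1 + s * cos a, p.2 + s * sin a)
  else (p.1 + (sin (a + k * s) - sin a) / k,
        p.2 + (cos a - cos (a + k * s)) / k).

Lemma cc_point0 (R : realType) (p : R * R) (a k : R) : cc_point p a k 0 = p.
Proof.
by rewrite /cc_point; case: p => x y /=; case: eqP => _;
  rewrite ?mulr0 ?mul0r ?addr0 ?subrr ?mul0r ?addr0.
Qed.

Lemma cc_point_derive (R : realType) (p : R * R) (a k s : R) :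
  is_derive s 1 (fun t => (cc_point p a k t).1) (unitv (a + k * s)).1 /\
  is_derive s 1 (fun t => (cc_point p a k t).2) (unitv (a + k * s)).2.
Proof.
have affine (f : R -> R) (x c d : R) : is_derive s 1 f d ->
    is_derive s 1 (fun t => x + c * f t) (c * d).
  move=> df; have -> : (fun t => x + c * f t) = cst x + c \*: f by [].
  by apply: is_derive_eq; rewrite add0r.
rewrite /cc_point /unitv /=; have [->|k0] := eqVneq k 0 => /=.
  have line (x c : R) : is_derive s 1 (fun t => x + t * c) c.
    have -> : (fun t => x + t * c) = (fun t => x + c * id t).
      by apply/funext => t; rewrite mulrC.
    by have := affine id x c _ (is_derive_id s 1); rewrite mulr1; apply.
  rewrite mul0r addr0; split; exact: line.
have turn : is_derive s 1 (fun t => a + k * t) k.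
  by have := affine id a k _ (is_derive_id s 1); rewrite mulr1; apply.
have dsin : is_derive s 1 (fun t => sin (a + k * t)) (cos (a + k * s) * k).
  exact: (is_derive1_comp (is_derive_sin _) turn).
have dcos : is_derive s 1 (fun t => cos (a + k * t)) (- sin (a + k * s) * k).
  exact: (is_derive1_comp (is_derive_cos _) turn).
split.
- have -> : (fun t => p.1 + (sin (a + k * t) - sin a) / k) =
      (fun t => (p.1 - sin a / k) + k^-1 * sin (a + k * t)).
    by apply/funext => t; ring.
  apply: (is_derive_eq (affine _ _ _ _ dsin)).
  by field.
- have -> : (fun t => p.2 + (cos a - cos (a + k * t)) / k) =
      (fun t => (p.2 + cos a / k) + (- k^-1) * cos (a + k * t)).
    by apply/funext => t; ring.
  apply: (is_derive_eq (affine _ _ _ _ dcos)).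
  by field.
Qed.

(* [orient true = 1] is counterclockwise. *)
Definition orient (R : realType) (b : bool) : R := if b then 1 else -1.

(* A 3-gon, with its boundary traversed vtx 0, vtx 1, vtx 2, vtx 0; indices are
   taken mod 3.  Edge i runs from vtx i to vtx (i + 1), has initial direction
   [unitv (heading i)], length [len i] and signed curvature [curv i].  The flag
   [ccw] says on which side of the directed edges the face lies: on the left if
   [ccw], on the right otherwise.  An edge bulges out of the face exactly when
   it curves towards the side of the face, so its tangent turns at the rate
   [orient ccw * curv i].  All labellings of the three edges are covered, since
   any one of them follows the boundary in one of its two senses. *)
Record trigon (R : realType) : Type := Trigon {
  face : set (R * R);
  vtx : 'I_3 -> R * R;
  heading : 'I_3 -> R;
  len : 'I_3 -> R;
  curv : 'I_3 -> R;
  ccw : bool;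
  edge_point := fun (i : 'I_3) (s : R) =>
    cc_point (vtx i) (heading i) (orient R ccw * curv i) s;
  edge_heading := fun (i : 'I_3) (s : R) =>
    heading i + orient R ccw * curv i * s;
  edge := fun i : 'I_3 => [set edge_point i s | s in `[0, len i]];
  len_gt0 : forall i, 0 < len i;
  edge_end : forall i, edge_point i (len i) = vtx (i + 1);
  (* the boundary is a simple closed curve *)
  edge_inj : forall i j s t, 0 <= s < len i -> 0 <= t < len j ->
    edge_point i s = edge_point j t -> i = j /\ s = t;
  face_open : open face;
  face_connected : connected face;
  face_bounded : bounded_set face;
  face_frontier : frontier face = \bigcup_i edge i;
  (* moving off an edge along its normal on the side given by [ccw], one
     enters the face *)
  face_side : forall i s, 0 < s < len i ->
    \forall t \near 0^'+,
      face (edge_point i s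
            + t *: unitv (edge_heading i s + orient R ccw * (pi / 2)));
  (* interior angles: rotating the direction of the edge leaving [vtx i] by
     2 pi / 3 through the face gives the direction, from [vtx i], of the edge
     arriving there, which is opposite to the heading at arrival *)
  interior_angle : forall i,
    unitv (heading i + orient R ccw * (2 * pi / 3)) =
    unitv (edge_heading (i - 1) (len (i - 1)) + pi)
}.

Definition congruent (R : realType) (G H : trigon R) : Prop :=
  exists f : R * R -> R * R,
    [/\ isometry f,
        f @` face G = face H,
        forall i, f (vtx G i) = vtx H i
      & forall i, f @` edge G i = edge H i].

Definition same_trigon (R : realType) (G H : trigon R) : Prop :=
  [/\ face G = face H,
      vtx G =1 vtx H,
      edge G =1 edge H
    & curv G =1 curv H].

Definition vector_angle (R : realType) (u v : R * R) : R :=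
  acos (dotp u v / (Num.sqrt (dotp u u) * Num.sqrt (dotp v v))).

(* A triangle A B C with an angle above 5 pi / 6 at A (possibly flat) is the
   vertex triangle of two different 3-gons, traversed in opposite senses.  The
   edge BC turns by 2 (angle A - pi / 6) in the one where it bulges away from
   A, and by 2 (11 pi / 6 - angle A) in the one where it passes around A.  When
   no angle exceeds 5 pi / 6 only the first kind exists. *)
Definition triangle_angle (R : realType) (v : 'I_3 -> R * R) (i : 'I_3) : R :=
  vector_angle (v (i + 1) - v i) (v (i - 1) - v i).

(* Main.v *)
Require Import Defs.
From mathcomp Require Import all_boot all_order all_algebra.
From mathcomp Require Import all_classical all_reals all_analysis.
From mathcomp Require Import ring lra.
Import Order.TTheory GRing.Theory Num.Theory.
Import numFieldNormedType.Exports.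
Local Open Scope classical_set_scope.
Local Open Scope ring_scope.

Set Implicit Arguments.
Unset Strict Implicit.
Unset Printing Implicit Defensive.

(* Let [d i] be the chord of edge [i], [2 * theta i] its turning, and
   [alpha i = theta i + pi / 6].  The angles 2 pi / 3 make the chord turn by
   [alpha i + alpha (i + 1)] from edge [i] to the next, so the sum of the [alpha i]
   is a multiple of [pi], and closing up gives the law of sines:
   [u = sin (alpha i) / d i] does not depend on [i].

   If the multiple is even, invert in a vertex: the two edges ending there become
   rays, and these cross, so the boundary is not simple.  This replaces Hopf's
   theorem on turning tangents.

   If it is odd, put [w i = cos (alpha i) / d i].  Then [curv i = sqrt 3 * u - w i],
   [\sum_i w i > 0] and [w 0 * w 1 + w 1 * w 2 + w 2 * w 0 = u ^+ 2].  These make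
   [u] the larger root of a quadratic equation determined by the curvatures, and
   [u] determines [d i] and [theta i].

   Vertices and sense of traversal determine [d] and the [alpha i] modulo [2 pi].
   The sign of [u] compares the sense of traversal with the orientation of the
   vertex triangle.  If [u <= 0] and no angle exceeds 5 pi / 6, then all
   curvatures are negative, and at the highest point of the boundary above a
   chord the face lies on the outer side, hence is unbounded.

   Faces with the same boundary agree because they are connected, avoid that
   boundary, and both contain the points close to an edge on the same side. *)

(** * Trigonometric values, and arcs described by their chords *)

Section Trigonometry.
Variable R : realType.
Implicit Types (a b c k l s t x y : R) (p : R * R).

(** By the triple angle formula [c = cos (pi / 3)] satisfies [4 c^3 - 3 c + 1 = 0], and the left
    side factors as [(c + 1) (2 c - 1)^2]. *)
Lemma cos_pi3 : cos (pi / 3) = 1 / 2 :> R.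
Proof.
set x : R := pi / 3; have pi0 := pi_gt0 R.
have c0 : 0 < cos x by apply: cos_gt0_pihalf; rewrite /x; lra.
have e : cos (x + (x + x)) = - 1 by rewrite -[RHS]cospi /x; congr cos; field.
have := cos2Dsin2 x; rewrite !cosD !sinD in e * => cs.
have : (cos x + 1) * (2 * cos x - 1) ^+ 2 = 0.
  rewrite (_ : _ * _ = cos x * (cos x * cos x - sin x * sin x)
    - sin x * (sin x * cos x + cos x * sin x) + 1
    + 3 * cos x * (cos x ^+ 2 + sin x ^+ 2 - 1)); last by ring.
  by rewrite e cs; ring.
move/eqP; rewrite mulf_eq0 expf_eq0 /= => /orP[|] /eqP; lra.
Qed.

Lemma sin_pi3_gt0 : 0 < sin (pi / 3) :> R.
Proof. by apply: sin_gt0_pi; have := pi_gt0 R; lra. Qed.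

Lemma sin_pi3_sqr : sin (pi / 3) ^+ 2 = 3 / 4 :> R.
Proof. have := cos2Dsin2 (pi / 3 : R); rewrite cos_pi3; lra. Qed.

Lemma sin_pi6 : sin (pi / 6) = 1 / 2 :> R.
Proof.
have -> : pi / 6 = - (pi / 3) + pi / 2 :> R by field.
by rewrite sinDpihalf cosN cos_pi3.
Qed.

Lemma cos_pi6 : cos (pi / 6) = sin (pi / 3) :> R.
Proof.
have -> : pi / 6 = - (pi / 3) + pi / 2 :> R by field.
by rewrite cosDpihalf sinN opprK.
Qed.

Lemma unitv_shift a b c : unitv a = unitv b -> unitv (a + c) = unitv (b + c).
Proof. by case=> ca sa; rewrite /unitv !cosD !sinD ca sa. Qed.

Lemma sin_eq0_itv x : - pi < x < pi -> sin x = 0 -> x = 0.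
Proof.
move=> /andP[x1 x2] s0; case: (ltgtP x 0) => // x0.
- have : 0 < sin (- x) by apply: sin_gt0_pi; lra.
  by rewrite sinN s0 oppr0 ltxx.
- have : 0 < sin x by apply: sin_gt0_pi; lra.
  by rewrite s0 ltxx.
Qed.

Lemma cos_eq1_itv x : - (2 * pi) < x < 2 * pi -> cos x = 1 -> x = 0.
Proof.
move=> xb cx; suff : x / 2 = 0 by lra.
apply: sin_eq0_itv; first lra.
have : cos (x / 2 + x / 2) = 1 by rewrite -[RHS]cx; congr cos; field.
rewrite cosD => e; have := cos2Dsin2 (x / 2) => e'.
by apply/eqP; rewrite -sqrf_eq0; apply/eqP; lra.
Qed.

Lemma unitv_inj_itv x y :
  - pi < x < pi -> - pi < y < pi -> unitv x = unitv y -> x = y.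
Proof.
move=> xb yb [cxy sxy]; apply/eqP; rewrite -subr_eq0; apply/eqP.
apply: cos_eq1_itv; first lra.
by rewrite cosD cosN sinN cxy sxy; have := cos2Dsin2 y; lra.
Qed.

(* The chord of an arc of curvature [k] and length [s]. *)
Definition chord k s := if k == 0 then s else 2 * sin (k * s / 2) / k.

(** The chord of an arc makes half the turning angle with the initial tangent. *)
Lemma cc_pointE p a k s :
  cc_point p a k s = p + chord k s *: unitv (a + k * s / 2).
Proof.
case: p => x y; rewrite /cc_point /chord /unitv; case: eqVneq => [->|k0].
  by rewrite !mul0r addr0.
have e1 : a + k * s = (a + k * s / 2) + k * s / 2 by field.
have e2 : sin a = sin ((a + k * s / 2) - k * s / 2) by congr sin; field.
have e3 : cos a = cos ((a + k * s / 2) - k * s / 2) by congr cos; field.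
rewrite /= e1 e2 e3 !(sinD, cosD, sinN, cosN).
congr (_, _) => /=; rewrite /GRing.scale /=; field => //.
Qed.

Lemma chordNl k s : chord (- k) s = chord k s.
Proof.
rewrite /chord oppr_eq0; case: eqP => // k0.
by rewrite !mulNr sinN invrN; ring.
Qed.

Lemma chordNr k s : chord k (- s) = - chord k s.
Proof.
by rewrite /chord; case: eqP => // k0; rewrite mulrN mulNr sinN; ring.
Qed.

Lemma chord_curv k s : k * chord k s = 2 * sin (k * s / 2).
Proof.
by rewrite /chord; case: eqVneq => [->|k0]; rewrite ?mul0r ?sin0 ?mulr0//; field.
Qed.

Lemma chord_gt0 k s : 0 < s -> `|k| * s < 2 * pi -> 0 < chord k s.
Proof.
move=> s0; wlog k0 : k / 0 <= k => [hw|].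
  have [k0|k0] := leP 0 k; first exact: hw.
  by rewrite -chordNl -normrN; apply: hw; lra.
rewrite ger0_norm // => ks; rewrite /chord; case: eqVneq => // kn0.
have kp : 0 < k by rewrite lt_neqAle eq_sym kn0.
have ks0 : 0 < k * s by rewrite mulr_gt0.
by rewrite divr_gt0 // mulr_gt0 //; apply: sin_gt0_pi; lra.
Qed.

Lemma cc_point_shift p a k s t :
  cc_point (cc_point p a k t) (a + k * t) k s = cc_point p a k (t + s).
Proof.
case: p => x y; rewrite /cc_point; case: eqVneq => [->|k0] /=.
  by rewrite mul0r addr0; congr pair; ring.
have -> : a + k * t + k * s = a + k * (t + s) by ring.
by congr pair; field.
Qed.

Lemma continuous_chord k : continuous (chord k).
Proof.
rewrite /chord; case: eqVneq => k0 s; first exact: cvg_id.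
apply: cvgMl; apply: cvgMr.
apply: (@continuous_comp _ _ _ (fun t => k * t / 2) sin); last exact: continuous_sin.
by apply: cvgMl; apply: cvgMr; exact: cvg_id.
Qed.

(** Inversion in the starting point turns the arc into a ray parallel to the initial tangent, the
    point at length [s] having abscissa [cos (k * s / 2) / chord k s]. When [chord k l] is positive,
    the hypothesis places [x] beyond the image of the far end. The intermediate value theorem is
    applied after clearing the denominator, which vanishes at [s = 0]. *)
Lemma arc_meets_ray k l x : 0 < l -> cos (k * l / 2) < x * chord k l ->
  exists2 s, 0 < s < l & x * chord k s = cos (k * s / 2).
Proof.
move=> l0 hl; pose g s := x * chord k s - cos (k * s / 2).
have chord0 : chord k 0 = 0.
  by rewrite /chord; case: eqP; rewrite // mulr0 mul0r sin0 mulr0 mul0r.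
have g0 : g 0 = -1 by rewrite /g chord0 !mulr0 mul0r cos0 sub0r.
have gl : 0 < g l by rewrite subr_gt0.
have cg : continuous g.
  move=> s; apply: cvgB; first by apply: cvgMr; exact: continuous_chord.
  apply: (@continuous_comp _ _ _ (fun t => k * t / 2) cos); last exact: continuous_cos.
  by apply: cvgMl; apply: cvgMr; exact: cvg_id.
have [||s] := @IVT R g 0 l 0 (ltW l0); first exact: continuous_subspaceT.
  by rewrite g0 ge_min le_max (ltW gl) orbT; lra.
rewrite in_itv /= => /andP[s0 sl] gs; exists s; last by apply/eqP; rewrite -subr_eq0 -/(g s) gs.
rewrite !lt_neqAle s0 sl !andbT; apply/andP; split.
  by apply/eqP => e; move: gs; rewrite -e g0; lra.
by apply/eqP => e; move: gs gl; rewrite e => ->; rewrite ltxx.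
Qed.

End Trigonometry.

(** * The chords of the boundary and the conditions for closing up *)

Section EdgeGeometry.
Variable R : realType.
Implicit Types (G : trigon R) (i : 'I_3) (s x : R).

Lemma I3_addK i : i + 1 + 1 + 1 = i.
Proof. by apply/val_inj; case: i => -[|[|[|]]]. Qed.

Lemma I3_sub1 i : i - 1 = i + 1 + 1.
Proof. by apply/val_inj; case: i => -[|[|[|]]]. Qed.

Lemma I3_neq i : i + 1 <> i.
Proof. by move/eqP; case: i => -[|[|[|]]]. Qed.

Lemma I3_case (P : 'I_3 -> Prop) : P 0 -> P 1 -> P (1 + 1) -> forall i, P i.
Proof.
move=> P0 P1 P2; case=> -[|[|[|//]]] h; [move: P0|move: P1|move: P2];
  by congr P; apply/val_inj.
Qed.

Lemma I3_ind (P : 'I_3 -> Prop) :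
  P 0 -> (forall i, P i -> P (i + 1)) -> forall i, P i.
Proof.
move=> P0 PS; have P1 : P 1 by rewrite -[1]add0r; exact: PS.
by apply: I3_case => //; exact: PS.
Qed.

Lemma I3_sum (f : 'I_3 -> R) i : f i + f (i + 1) + f (i + 1 + 1) = f 0 + f 1 + f (1 + 1).
Proof.
elim/I3_ind: i => [|i <-]; first by rewrite add0r.
by rewrite I3_addK; ring.
Qed.

Lemma orient_sqr b : orient R b * orient R b = 1.
Proof. by case: b; rewrite /orient; ring. Qed.

Lemma cos_orient b x : cos (orient R b * x) = cos x.
Proof. by case: b; rewrite /orient ?mul1r // mulN1r cosN. Qed.

Lemma sin_orient b x : sin (orient R b * x) = orient R b * sin x.
Proof. by case: b; rewrite /orient ?mul1r // !mulN1r sinN. Qed.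

(** [half] and [side] are the [theta i] and [d i] of the overview. *)
Definition half G i := curv G i * len G i / 2.
Definition side G i := chord (curv G i) (len G i).
(* Modulo [2 * pi], the signed angle of the vertex triangle opposite edge [i]; see
   [cos_totalN1]. *)
Definition alpha G i := half G i + pi / 6.
Definition chord_dir G i := heading G i + orient R (ccw G) * half G i.

Lemma edge_pointE G i s : edge_point G i s =
  vtx G i + chord (curv G i) s *:
    unitv (heading G i + orient R (ccw G) * (curv G i * s / 2)).
Proof.
rewrite /edge_point cc_pointE; case: ccw; rewrite /orient ?mul1r // mulN1r.
by rewrite chordNl; congr (_ + _ *: unitv _); ring.
Qed.

Lemma edge_point0 G i : edge_point G i 0 = vtx G i.
Proof. exact: cc_point0. Qed.

(* A full circle would bring the edge back to its starting vertex. *)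
Lemma edge_turn_lt G i : `|curv G i| * len G i < 2 * pi.
Proof.
rewrite ltNge; apply/negP => big; have pi0 := pi_gt0 R.
have k0 : curv G i != 0 by apply/eqP => k0; move: big; rewrite k0 normr0; lra.
have kp : 0 < `|curv G i| by rewrite normr_gt0.
pose s := 2 * pi / `|curv G i|.
have s0 : 0 < s by rewrite divr_gt0 //; lra.
have sl : s <= len G i by rewrite ler_pdivrMr // [len G i * _]mulrC.
have back : edge_point G i s = edge_point G i 0.
  rewrite edge_point0 edge_pointE /chord (negPf k0).
  suff -> : sin (curv G i * s / 2) = 0 by rewrite mulr0 mul0r scale0r addr0.
  rewrite /s; have [sk|sk] := ltP 0 (curv G i).
    rewrite gtr0_norm //; have -> : curv G i * (2 * pi / curv G i) / 2 = pi by field.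
    exact: sinpi.
  rewrite ler0_norm //; have -> : curv G i * (2 * pi / - curv G i) / 2 = - pi by field.
  by rewrite sinN sinpi oppr0.
have i0 := len_gt0 G i; have i1 := len_gt0 G (i + 1).
(* [edge_inj] leaves out the far endpoint of an edge, so a circle that closes exactly there is
   refuted at parameter [0] of the next edge. *)
move: sl; rewrite le_eqVlt => /orP[/eqP sl|sl].
  have : edge_point G (i + 1) 0 = edge_point G i 0.
    by rewrite edge_point0 -edge_end -sl.
  by move/edge_inj; rewrite !lexx /= => /(_ i1 i0)[/I3_neq].
move/edge_inj: back; rewrite lexx (ltW s0) /= => /(_ sl i0)[_ e].
by move: s0; rewrite e ltxx.
Qed.

Lemma side_gt0 G i : 0 < side G i.
Proof. exact/chord_gt0/edge_turn_lt/len_gt0. Qed.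

Lemma half_itv G i : - pi < half G i < pi.
Proof.
have := edge_turn_lt G i; rewrite -(gtr0_norm (len_gt0 G i)) -normrM => h.
have /ltr_normlP[h1 h2] := h.
by rewrite /half; apply/andP; split; lra.
Qed.

Lemma curv_side G i : curv G i * side G i = 2 * sin (half G i).
Proof. exact: chord_curv. Qed.

Lemma vtx_step G i : vtx G (i + 1) = vtx G i + side G i *: unitv (chord_dir G i).
Proof. by rewrite -edge_end edge_pointE. Qed.

Lemma heading_step G i : unitv (heading G (i + 1)) =
  unitv (heading G i + orient R (ccw G) * (2 * half G i + pi / 3)).
Proof.
have := interior_angle G (i + 1); rewrite addrK => /(unitv_shift (- (orient R (ccw G) * (2 * pi / 3)))).
rewrite addrK => ->; rewrite /edge_heading /half; case: ccw; rewrite /orient.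
  by congr unitv; field.
(* For a clockwise boundary the two angles differ by a full turn. *)
set x := (X in unitv X); set y := (X in _ = unitv X).
have -> : x = y + pi *+ 2 by rewrite /x /y; field.
by rewrite /unitv sinD2pi cosD2pi.
Qed.

(** Each of the two edges contributes half of its turning, and the vertex its exterior angle
    [pi / 3]. Sharing the latter equally explains the [pi / 6] in [alpha]. *)
Lemma chord_dir_step G i : unitv (chord_dir G (i + 1)) =
  unitv (chord_dir G i + orient R (ccw G) * (alpha G i + alpha G (i + 1))).
Proof.
rewrite /chord_dir (unitv_shift _ (heading_step G i)) /alpha.
by congr unitv; field.
Qed.

Definition total G := alpha G 0 + alpha G 1 + alpha G (1 + 1).

Lemma totalE G i : alpha G i + alpha G (i + 1) + alpha G (i + 1 + 1) = total G.
Proof. exact: I3_sum. Qed.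

(** Once around the boundary every [alpha] occurs in two steps, so the chord direction turns by
    [2 * total G], which must be a multiple of [2 * pi]. *)
Lemma sin_total G : sin (total G) = 0.
Proof.
set o := orient R (ccw G); set t := total G; pose a := chord_dir G 0.
have e : unitv a = unitv (a + o * (t + t)).
  rewrite /t -{2}(totalE G (0 + 1)) -(totalE G 0) /a.
  move: (chord_dir_step G 0) (chord_dir_step G (0 + 1)) (chord_dir_step G (0 + 1 + 1)).
  rewrite I3_addK => s1 s2 ->; rewrite (unitv_shift _ s2) -addrA (unitv_shift _ s1).
  by congr unitv; rewrite -/o; ring.
have := unitv_shift (- a) e; rewrite subrr addrAC subrr add0r.
rewrite /unitv cos_orient cos0 => -[e1 _].
by apply/eqP; rewrite -sqrf_eq0; apply/eqP; have := cos2Dsin2 t;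
  move: e1; rewrite cosD; lra.
Qed.

Lemma cos_total G : cos (total G) = 1 \/ cos (total G) = -1.
Proof.
have := cos2Dsin2 (total G); rewrite sin_total expr0n addr0 => /eqP.
by rewrite sqrf_eq1 => /orP[] /eqP; [left|right].
Qed.

Lemma cos_alphaD G i :
  cos (alpha G i + alpha G (i + 1)) = cos (total G) * cos (alpha G (i + 1 + 1)).
Proof.
rewrite -(addrK (alpha G (i + 1 + 1)) (_ + _)) totalE cosD cosN sinN sin_total.
by ring.
Qed.

Lemma sin_alphaD G i :
  sin (alpha G i + alpha G (i + 1)) = - cos (total G) * sin (alpha G (i + 1 + 1)).
Proof.
rewrite -(addrK (alpha G (i + 1 + 1)) (_ + _)) totalE sinD cosN sinN sin_total.
by ring.
Qed.

(** The three chord vectors add up to zero; the two equations are the components of this along chord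
    [j] and across it. *)
Lemma closing G i : let j := i + 1 in let k := i + 1 + 1 in
  side G j + cos (total G) *
    (side G i * cos (alpha G k) + side G k * cos (alpha G i)) = 0 /\
  side G i * sin (alpha G k) = side G k * sin (alpha G i).
Proof.
move=> j k; set o := orient R (ccw G); set b := chord_dir G j.
have ei : unitv (chord_dir G i) = unitv (b - o * (alpha G i + alpha G j)).
  by rewrite (unitv_shift _ (chord_dir_step G i)) addrK.
have ek := chord_dir_step G j; rewrite -/k -/b -/o in ek.
have := vtx_step G k; rewrite {1}/k I3_addK {1}/k vtx_step /j vtx_step -/j.
rewrite ei ek -!addrA => e.
have {}e : side G i *: unitv (b - o * (alpha G i + alpha G j)) + side G j *: unitv b
   + side G k *: unitv (b + o * (alpha G j + alpha G k)) = 0.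
  by apply: (addrI (vtx G i)); rewrite addr0 -!addrA -e.
have ci := cos_alphaD G i; have si := sin_alphaD G i.
have cj := cos_alphaD G j; have sj := sin_alphaD G j.
rewrite -/j -/k in ci si cj sj.
have ki : k + 1 = i by rewrite /k I3_addK.
rewrite ki in cj sj.
move: e; rewrite /unitv !(cosD b) !(sinD b) !cosN !sinN !cos_orient !sin_orient.
rewrite ci si cj sj -/o => -[e1 e2].
have oo : o * o = 1 by exact: orient_sqr.
have cs := cos2Dsin2 b.
have tt : cos (total G) * cos (total G) = 1.
  by have := cos2Dsin2 (total G); rewrite sin_total; lra.
move: e1 e2; rewrite /GRing.scale /= => e1 e2.
split.
  set A := (X in X = 0); rewrite -[A]mulr1 -cs.
  by transitivity (0 * cos b + 0 * sin b); [rewrite -{1}e1 -e2 /A; ring|ring].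
apply/eqP; rewrite -subr_eq0; apply/eqP; set B := (X in X = 0).
have -> : B = (o * o) * (cos (total G) * cos (total G)) * (B * (cos b ^+ 2 + sin b ^+ 2)).
  by rewrite oo tt cs !mul1r mulr1.
transitivity (o * cos (total G) * (0 * cos b - 0 * sin b)); last by ring.
by rewrite -{1}e2 -e1 /B; ring.
Qed.

End EdgeGeometry.

(** * The sum of the [alpha] is an odd multiple of [pi] *)

Section TotalTurning.
Variable R : realType.
Implicit Types (G : trigon R) (i : 'I_3) (s x : R).

Lemma closing_next G i :
  side G (i + 1 + 1) + cos (total G) *
    (side G i * cos (alpha G (i + 1)) + side G (i + 1) * cos (alpha G i)) = 0 /\
  side G (i + 1) * sin (alpha G i) = side G i * sin (alpha G (i + 1)).
Proof.
have [e1 e2] := closing G (i + 1); rewrite I3_addK in e1 e2.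
by split => //; rewrite -e1; ring.
Qed.

Lemma sin_half G i :
  sin (half G i) = sin (pi / 3) * sin (alpha G i) - cos (alpha G i) / 2.
Proof.
rewrite -(addrK (pi / 6) (half G i)) -/(alpha G i) sinD cosN sinN cos_pi6 sin_pi6.
by field.
Qed.

Lemma cos_half G i :
  cos (half G i) = sin (pi / 3) * cos (alpha G i) + sin (alpha G i) / 2.
Proof.
rewrite -(addrK (pi / 6) (half G i)) -/(alpha G i) cosD cosN sinN cos_pi6 sin_pi6.
by field.
Qed.

Lemma edge_pointB G i s : edge_point G i (len G i - s) =
  vtx G (i + 1) - chord (curv G i) s *:
    unitv (heading G i + orient R (ccw G) * (2 * half G i - curv G i * s / 2)).
Proof.
rewrite {1}/edge_point -cc_point_shift -/(edge_point G i _) edge_end cc_pointE chordNr.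
rewrite scaleNr /half; case: ccw; rewrite /orient.
  by congr (_ - chord _ _ *: unitv _); field.
by rewrite mulN1r chordNl; congr (_ - _ *: unitv _); field.
Qed.

(* Inverting in the vertex [i + 1] turns the two edges ending there into rays
   that make an angle [pi / 3]; [x] and [y] are the abscissas of the crossing
   point of the two lines, measured along these rays. *)
Lemma edges_cross G i (j := i + 1) :
  side G i * cos (alpha G j) + side G j * cos (alpha G i) < 0 ->
  exists s t, [/\ 0 < s < len G j, 0 < t < len G i &
    edge_point G j s = edge_point G i (len G i - t)].
Proof.
set q : R := sin (pi / 3); have q0 : 0 < q := sin_pi3_gt0 R.
have qq : q ^+ 2 = 3 / 4 := sin_pi3_sqr R.
set k' := curv G i; set k := curv G j; move=> neg.
have di := side_gt0 G i; have dj := side_gt0 G j.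
have [_ sine] := closing_next G i; rewrite -/j in sine.
have ki := curv_side G i; have kj := curv_side G j.
rewrite sin_half -/q -/k' in ki; rewrite sin_half -/q -/k in kj.
(* The inverted edges lie on lines at signed distances [k / 2] and [k' / 2] from the vertex; two
   linear equations give their common point. *)
pose x := (k' - k / 2) / (2 * q); pose y := (k - k' / 2) / (2 * q).
have di0 : side G i != 0 by rewrite gt_eqF.
have dj0 : side G j != 0 by rewrite gt_eqF.
have q_neq0 : q != 0 by rewrite gt_eqF.
set D := side G i * cos (alpha G j) + side G j * cos (alpha G i) in neg.
have k'E : k' = (2 * q * sin (alpha G i) - cos (alpha G i)) / side G i.
  by apply: (mulIf di0); rewrite ki; field.
have kE : k = (2 * q * sin (alpha G j) - cos (alpha G j)) / side G j.
  by apply: (mulIf dj0); rewrite kj; field.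
have sE : sin (alpha G i) = side G i * sin (alpha G j) / side G j.
  by rewrite -sine; field.
(* Both excesses over the image of a far vertex are positive multiples of [- D], so the crossing
   point of the lines lies on both rays. *)
have hx : x * side G j - cos (half G j) = - D / (2 * q * side G i).
  apply/eqP; rewrite -subr_eq0; apply/eqP.
  rewrite /x cos_half -/q k'E kE sE /D.
  transitivity (cos (alpha G j) * (3 / 4 - q ^+ 2) / q); last by rewrite qq subrr mulr0 mul0r.
  by field; rewrite q_neq0 di0 dj0.
have hy : y * side G i - cos (half G i) = - D / (2 * q * side G j).
  apply/eqP; rewrite -subr_eq0; apply/eqP.
  rewrite /y cos_half -/q k'E kE sE /D.
  transitivity (cos (alpha G i) * (3 / 4 - q ^+ 2) / q); last by rewrite qq subrr mulr0 mul0r.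
  by field; rewrite q_neq0 di0 dj0.
have [s sl xs] : exists2 s, 0 < s < len G j & x * chord k s = cos (k * s / 2).
  apply: arc_meets_ray; first exact: len_gt0.
  by rewrite -subr_gt0 -/(half G j) -/(side G j) hx divr_gt0 ?oppr_gt0 // !mulr_gt0.
have [t tl yt] : exists2 t, 0 < t < len G i & y * chord k' t = cos (k' * t / 2).
  apply: arc_meets_ray; first exact: len_gt0.
  by rewrite -subr_gt0 -/(half G i) -/(side G i) hy divr_gt0 ?oppr_gt0 // !mulr_gt0.
exists s, t; split => //; rewrite edge_pointB edge_pointE -/j -/k -/k'.
have ks := chord_curv k s; have kt := chord_curv k' t.
set o := orient R (ccw G).
set c := chord k s in xs ks *; set c' := chord k' t in yt kt *.
set a := heading G i + o * (2 * half G i).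
(* [M] is the squared distance of the inverted crossing point from the vertex, computed along either
   line; both chords are inverse to this distance. *)
have N : c ^+ 2 = c' ^+ 2.
  pose M := (k' ^+ 2 - k * k' + k ^+ 2) / 3.
  have M1 : c ^+ 2 * M = 1.
    rewrite -(cos2Dsin2 (k * s / 2)) -xs (_ : sin _ = k * c / 2); last by rewrite ks; field.
    rewrite (_ : M = x ^+ 2 + k ^+ 2 / 4); first by field.
    by rewrite /M /x expr_div_n exprMn qq; field.
  have M2 : c' ^+ 2 * M = 1.
    rewrite -(cos2Dsin2 (k' * t / 2)) -yt (_ : sin _ = k' * c' / 2); last by rewrite kt; field.
    rewrite (_ : M = y ^+ 2 + k' ^+ 2 / 4); first by field.
    by rewrite /M /y expr_div_n exprMn qq; field.
  have M0 : M != 0 by apply/eqP => M0; move: M1; rewrite M0 mulr0 => /esym/eqP; rewrite oner_eq0.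
  by apply: (mulIf M0); rewrite M1 M2.
have hj : unitv (heading G j + o * (k * s / 2)) = unitv (a + o * (pi / 3 + k * s / 2)).
  by rewrite (unitv_shift _ (heading_step G i)); congr unitv; rewrite /a /o; ring.
have hi : heading G i + o * (2 * half G i - k' * t / 2) = a + o * (- (k' * t / 2)).
  by rewrite /a; ring.
rewrite hj hi -scaleNr; congr (_ + _).
(* The displacements from the vertex are compared along and across [unitv a], the heading in which
   edge [i] arrives. *)
have e1 : c * cos (pi / 3 + k * s / 2) = - c' * cos (- (k' * t / 2)).
  rewrite cosN cosD cos_pi3 -/q -xs -yt (_ : sin _ = k * c / 2); last by rewrite ks; field.
  transitivity (c ^+ 2 * ((k' / 2 - k / 4 - q ^+ 2 * k) / (2 * q))); first by rewrite /x; field.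
  by rewrite qq N /y; field.
have e2 : c * sin (pi / 3 + k * s / 2) = - c' * sin (- (k' * t / 2)).
  rewrite sinN sinD cos_pi3 -/q -xs (_ : sin (k * s / 2) = k * c / 2); last by rewrite ks; field.
  rewrite (_ : sin _ = k' * c' / 2); last by rewrite kt; field.
  transitivity (c ^+ 2 * (k' / 2)); first by rewrite /x; field.
  by rewrite N; ring.
rewrite /unitv !(cosD a) !(sinD a) !cos_orient !sin_orient -/o.
congr pair; rewrite /GRing.scale /=.
- transitivity (cos a * (c * cos (pi / 3 + k * s / 2)) - o * sin a * (c * sin (pi / 3 + k * s / 2))).
    by ring.
  by rewrite e1 e2; ring.
- transitivity (sin a * (c * cos (pi / 3 + k * s / 2)) + o * cos a * (c * sin (pi / 3 + k * s / 2))).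
    by ring.
  by rewrite e1 e2; ring.
Qed.

(** With cosine [1], [closing_next] makes the sum in [edges_cross] equal to minus a side, hence
    negative, and the crossing contradicts [edge_inj]. *)
Lemma cos_totalN1 G : cos (total G) = -1.
Proof.
case: (cos_total G) => // e; exfalso.
have [c _] := closing_next G 0; rewrite e mul1r in c.
have d := side_gt0 G (0 + 1 + 1).
have [|s [t [sl tl]]] := @edges_cross G 0; first lra.
by case/(edge_inj _ _) => [||/I3_neq]; lra.
Qed.

End TotalTurning.

(** * The curvatures determine chords and turnings *)

Section Shape.
Variable R : realType.
Implicit Types (G H : trigon R) (i : 'I_3).

(* The reciprocal of the signed diameter of the circle through the vertices,
   positive when the vertex triangle has the orientation of the boundary and
   [0] when the vertices are collinear. *)
Definition inv_diam G := sin (alpha G 0) / side G 0.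
(** The [w i] of the overview: [inv_diam G] times the cotangent of [alpha G i], in a form that still
    makes sense for collinear vertices. *)
Definition cot_diam G i := cos (alpha G i) / side G i.

Lemma side_neq0 G i : side G i != 0.
Proof. by rewrite gt_eqF // side_gt0. Qed.

Lemma sin_alpha G i : sin (alpha G i) = inv_diam G * side G i.
Proof.
elim/I3_ind: i => [|i IH]; first by rewrite /inv_diam divfK // side_neq0.
have [_ e] := closing_next G i; apply: (mulfI (side_neq0 G i)).
by rewrite -e IH; ring.
Qed.

Lemma cos_alpha G i : cos (alpha G i) = cot_diam G i * side G i.
Proof. by rewrite /cot_diam divfK // side_neq0. Qed.

Lemma side_next2 G i : side G (i + 1 + 1) =
  side G i * cos (alpha G (i + 1)) + side G (i + 1) * cos (alpha G i).
Proof. by have [+ _] := closing_next G i; rewrite cos_totalN1; lra. Qed.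

(** The projection formula [side_next2] reads [d k = d i * d j * (w i + w j)], and sides are
    positive. *)
Lemma cot_diamD_gt0 G i : 0 < cot_diam G i + cot_diam G (i + 1).
Proof.
have := side_next2 G i; rewrite !cos_alpha => e.
have d0 := side_gt0 G i; have d1 := side_gt0 G (i + 1).
have d2 := side_gt0 G (i + 1 + 1).
have : 0 < side G i * side G (i + 1) * (cot_diam G i + cot_diam G (i + 1)).
  by move: d2; rewrite e; lra.
by rewrite pmulr_rgt0 // mulr_gt0.
Qed.

Lemma inv_side_sqr G i :
  (side G i ^+ 2) * (inv_diam G ^+ 2 + cot_diam G i ^+ 2) = 1.
Proof. by rewrite -(cos2Dsin2 (alpha G i)) sin_alpha cos_alpha; ring. Qed.

(** Expand [curv * side = 2 * sin (alpha - pi / 6)] and divide by [side]. Equal curvatures thus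
    allow only a common shift of the three [w i]. *)
Lemma curv_inv_diam G i :
  curv G i = 2 * sin (pi / 3) * inv_diam G - cot_diam G i.
Proof.
apply: (mulIf (side_neq0 G i)); rewrite curv_side sin_half sin_alpha cos_alpha.
by field.
Qed.

(** The identity for cotangents of the angles of a triangle, without denominators. By the projection
    formulas [(w 0 + w 1) * (w 0 + w 2)] is [1 / d 0 ^+ 2], which equals [u ^+ 2 + w 0 ^+ 2]. *)
Lemma cot_diam_mul G : let w := cot_diam G in
  w 0 * w 1 + w 1 * w (1 + 1) + w (1 + 1) * w 0 = inv_diam G ^+ 2.
Proof.
move=> w; have s1 := side_next2 G 0; have s2 := side_next2 G (0 + 1 + 1).
have n0 := side_neq0 G 0; have n1 := side_neq0 G 1; have n2 := side_neq0 G (1 + 1).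
rewrite !I3_addK !add0r !cos_alpha -/w in s1 s2.
have q0 := inv_side_sqr G 0; rewrite -/w in q0.
have e1 : side G (1 + 1) / (side G 0 * side G 1) = w 0 + w 1.
  by rewrite s1; field; rewrite n0 n1.
have e2 : side G 1 / (side G 0 * side G (1 + 1)) = w 0 + w (1 + 1).
  by rewrite s2; field; rewrite n0 n2.
have : (w 0 + w 1) * (w 0 + w (1 + 1)) = inv_diam G ^+ 2 + w 0 ^+ 2.
  rewrite -e1 -e2; apply: (mulfI (expf_neq0 2 n0)); rewrite q0.
  by field; rewrite n0 n1 n2.
by move=> e; lra.
Qed.

Definition cot_sum G := cot_diam G 0 + cot_diam G 1 + cot_diam G (1 + 1).

Lemma cot_sum_gt0 G : 0 < cot_sum G.
Proof.
have := cot_diamD_gt0 G 0; have := cot_diamD_gt0 G (0 + 1).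
have := cot_diamD_gt0 G (0 + 1 + 1); rewrite !I3_addK !add0r /cot_sum; lra.
Qed.

(** Substituting [w i = sqrt 3 * u - curv i] into [cot_diam_mul] gives a quadratic equation for [u];
    the inequality says that its derivative is positive at [u], so that [u] is the larger root. It
    follows from [3 * u ^+ 2 <= cot_sum G ^+ 2]. *)
Lemma inv_diam_lt G : inv_diam G < 2 * sin (pi / 3) * cot_sum G.
Proof.
have q0 := sin_pi3_gt0 R; have qq := sin_pi3_sqr R; have w0 := cot_sum_gt0 G.
have := cot_diam_mul G; rewrite /cot_sum /= in w0 *.
set u := inv_diam G; set q := sin _ in q0 qq *.
set a := cot_diam G 0; set b := cot_diam G 1; set c := cot_diam G _ => e.
rewrite -/a -/b -/c in w0.
rewrite ltNge; apply/negP => hu.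
have p0 : 0 < 2 * q * (a + b + c) by rewrite !mulr_gt0.
have u0 : 0 < u by lra.
have le : (2 * q * (a + b + c)) ^+ 2 <= u ^+ 2.
  by rewrite ler_pXn2r // nnegrE ltW.
have e4 : (2 * q * (a + b + c)) ^+ 2 = 3 * (a + b + c) ^+ 2.
  by rewrite !exprMn qq; field.
have u2 : 0 < u ^+ 2 by rewrite exprn_gt0.
have sq1 := sqr_ge0 (a - b); have sq2 := sqr_ge0 (b - c); have sq3 := sqr_ge0 (c - a).
have : 3 * u ^+ 2 <= (a + b + c) ^+ 2.
  rewrite -e -subr_ge0.
  rewrite (_ : _ - _ = ((a - b) ^+ 2 + (b - c) ^+ 2 + (c - a) ^+ 2) / 2); last by field.
  by rewrite divr_ge0 // !addr_ge0.
by lra.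
Qed.

Lemma inv_diam_curv G H : curv G =1 curv H -> inv_diam G = inv_diam H.
Proof.
move=> kGH; have dw i : cot_diam G i =
    cot_diam H i + 2 * sin (pi / 3) * (inv_diam G - inv_diam H).
  by have := kGH i; rewrite !curv_inv_diam; lra.
have mG := cot_diam_mul G; have mH := cot_diam_mul H.
have lG := inv_diam_lt G; have lH := inv_diam_lt H; have qq := sin_pi3_sqr R.
move: mG mH lG lH; rewrite /= /cot_sum !dw.
set a := cot_diam H 0; set b := cot_diam H 1; set c := cot_diam H (1 + 1).
set q := sin _ in qq *; set u := inv_diam G; set v := inv_diam H => mG mH lG lH.
(* [L] is the mean of the derivatives of that quadratic at [u] and [v], hence its difference
   quotient. *)
pose L := 2 * q * (a + b + c + 3 * (2 * q * (u - v))) - u + (2 * q * (a + b + c) - v).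
have L0 : 0 < L by rewrite /L; lra.
suff : (u - v) * L = 0.
  by move/eqP; rewrite mulf_eq0 (gt_eqF L0) orbF subr_eq0 => /eqP.
rewrite /L; transitivity (u ^+ 2 - v ^+ 2 - u ^+ 2 + v ^+ 2); last by ring.
rewrite -{1}mG -{1}mH.
ring: qq.
Qed.

Lemma side_half_curv G H : curv G =1 curv H -> forall i,
  side G i = side H i /\ half G i = half H i.
Proof.
move=> kGH i; have u := inv_diam_curv kGH.
have w : cot_diam G i = cot_diam H i by have := kGH i; rewrite !curv_inv_diam u; lra.
have d : side G i = side H i.
  have := inv_side_sqr G i; rewrite -(inv_side_sqr H i) w u => /mulIf e.
  have /e : inv_diam H ^+ 2 + cot_diam H i ^+ 2 != 0.
    apply/eqP => z; have := inv_side_sqr H i; rewrite z mulr0 => /esym/eqP.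
    by rewrite oner_eq0.
  by move/eqP; rewrite eqrXn2 ?ltW ?side_gt0// => /eqP.
split=> //; apply: unitv_inj_itv; [exact: half_itv|exact: half_itv|].
by rewrite /unitv !sin_half !cos_half !sin_alpha !cos_alpha u w d.
Qed.

(** A straight edge is as long as its chord; the length of a curved one is its turning divided by
    its curvature. *)
Lemma len_half G H i : curv G i = curv H i -> side G i = side H i ->
  half G i = half H i -> len G i = len H i.
Proof.
rewrite /side /chord /half => k; rewrite k; case: eqVneq => // k0 _ e.
by apply: (mulfI k0); lra.
Qed.

End Shape.

(** * Plane isometries and the transport of faces *)

Section RigidMotion.
Variable R : realType.
Implicit Types (G H : trigon R) (i : 'I_3) (b : bool) (a psi t s x : R) (z p q : R * R).

(** Rotation by [psi], preceded by the reflection in the first axis when [b] is [false]. *)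
Definition lin b psi z : R * R :=
  (z.1 * cos psi - orient R b * z.2 * sin psi,
   z.1 * sin psi + orient R b * z.2 * cos psi).

Definition motion b psi p q z : R * R := q + lin b psi (z - p).

Lemma linD b psi z1 z2 : lin b psi (z1 + z2) = lin b psi z1 + lin b psi z2.
Proof. by rewrite /lin; congr pair => /=; ring. Qed.

Lemma linZ b psi t z : lin b psi (t *: z) = t *: lin b psi z.
Proof. by case: z => x y; rewrite /lin; congr pair => /=; rewrite /GRing.scale /=; ring. Qed.

Lemma linN b psi z : lin b psi (- z) = - lin b psi z.
Proof. by rewrite -scaleN1r linZ scaleN1r. Qed.

Lemma lin_unitv b psi a : lin b psi (unitv a) = unitv (orient R b * a + psi).
Proof.
rewrite /lin /unitv /= sinD cosD sin_orient cos_orient.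
by congr pair; ring.
Qed.

Lemma linK b psi : cancel (lin b psi) (lin b (- (orient R b * psi))).
Proof.
case=> x y; rewrite /lin /= cosN sinN sin_orient cos_orient.
have cs := cos2Dsin2 psi; have oo := orient_sqr R b; congr pair.
  transitivity (x * (cos psi ^+ 2 + orient R b * orient R b * sin psi ^+ 2)
    + orient R b * y * sin psi * cos psi * (orient R b * orient R b - 1)); first by ring.
  by rewrite oo mul1r cs subrr mulr0 addr0 mulr1.
transitivity (orient R b * orient R b * y * (cos psi ^+ 2 + sin psi ^+ 2)); first by ring.
by rewrite oo cs mul1r mulr1.
Qed.

Lemma motionK b psi p q :
  cancel (motion b psi p q) (motion b (- (orient R b * psi)) q p).
Proof. by move=> z; rewrite /motion [q + _]addrC addrK linK addrC subrK. Qed.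

Lemma motion_isometry b psi p q : Defs.isometry (motion b psi p q).
Proof.
move=> z1 z2; rewrite /edist; congr Num.sqrt.
have -> : motion b psi p q z1 - motion b psi p q z2 = lin b psi (z1 - z2).
  by rewrite /motion opprD addrACA subrr add0r -linN -linD opprB addrA subrK.
rewrite /dotp /lin /=; set x := (z1 - z2).1; set y := (z1 - z2).2.
have cs := cos2Dsin2 psi; have oo := orient_sqr R b.
transitivity (x * x * (cos psi ^+ 2 + sin psi ^+ 2) +
  orient R b * orient R b * (y * y) * (cos psi ^+ 2 + sin psi ^+ 2)); first by ring.
by rewrite oo cs !mulr1 mul1r.
Qed.

Lemma motion_continuous b psi p q : continuous (motion b psi p q).
Proof.
move=> z; have c1 : (y.1 - p.1) @[y --> z] --> z.1 - p.1.
  by apply: cvgB; [exact: cvg_fst|exact: cvg_cst].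
have c2 : (y.2 - p.2) @[y --> z] --> z.2 - p.2.
  by apply: cvgB; [exact: cvg_snd|exact: cvg_cst].
have d1 : (q.1 + ((y.1 - p.1) * cos psi - orient R b * (y.2 - p.2) * sin psi)) @[y --> z]
    --> q.1 + ((z.1 - p.1) * cos psi - orient R b * (z.2 - p.2) * sin psi).
  by apply: cvgD; [exact: cvg_cst|apply: cvgB; apply: cvgMl => //; apply: cvgMr].
have d2 : (q.2 + ((y.1 - p.1) * sin psi + orient R b * (y.2 - p.2) * cos psi)) @[y --> z]
    --> q.2 + ((z.1 - p.1) * sin psi + orient R b * (z.2 - p.2) * cos psi).
  by apply: cvgD; [exact: cvg_cst|apply: cvgD; apply: cvgMl => //; apply: cvgMr].
exact: (cvg_pair d1 d2).
Qed.

Lemma face_frontier0 G z : face G z -> frontier (face G) z -> False.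
Proof. by move=> Gz [_]; rewrite ((interior_id _).1 (@face_open R G)). Qed.

(** Away from the frontier the face coincides with its closure, so its trace on [A] is open and
    closed in [A]. *)
Lemma connected_face_sub G (A : set (R * R)) z : connected A -> A z ->
  face G z -> (forall y, A y -> ~ frontier (face G) y) -> A `<=` face G.
Proof.
move=> cA Az Gz off; suff <- : A `&` face G = A by exact: subIsetr.
apply: cA; first by exists z.
- by exists (face G) => //; exact: face_open.
- exists (closure (face G)); first exact: closed_closure.
  apply/seteqP; split=> y [Ay Gy]; split=> //; first exact: subset_closure.
  apply: contrapT => nGy; apply: (off y Ay); split=> //.
  by rewrite ((interior_id _).1 (@face_open R G)).
Qed.

(** Only boundary data are compared; agreement of the faces is a consequence. By the third condition
    a reflection exchanges the two senses of traversal. *)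
Definition matches G H b psi p q := [/\ curv G =1 curv H, len G =1 len H,
  orient R b * orient R (ccw G) = orient R (ccw H),
  forall i, motion b psi p q (vtx G i) = vtx H i &
  forall i, unitv (heading H i) = unitv (orient R b * heading G i + psi)].

Section Matching.
Variables (G H : trigon R) (b : bool) (psi : R) (p q : R * R).
Hypothesis GH : matches G H b psi p q.
Let f := motion b psi p q.

Lemma matches_dir i x :
  lin b psi (unitv (heading G i + orient R (ccw G) * x)) =
  unitv (heading H i + orient R (ccw H) * x).
Proof.
have [_ _ o _ h] := GH; rewrite lin_unitv (unitv_shift _ (h i)) -o.
by congr unitv; ring.
Qed.

Lemma matches_edge_point i s : f (edge_point G i s) = edge_point H i s.
Proof.
have [k _ _ v _] := GH; rewrite !edge_pointE /f /motion addrAC linD linZ.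
by rewrite matches_dir addrA -/(motion b psi p q _) v k.
Qed.

Lemma matches_edge i : f @` edge G i = edge H i.
Proof.
have [_ l _ _ _] := GH; apply/seteqP; split=> z.
  by move=> [_ [s sl <-] <-]; exists s; rewrite ?matches_edge_point // -l.
by move=> [s sl <-]; exists (edge_point G i s); rewrite ?matches_edge_point //; exists s; rewrite ?l.
Qed.

(** The motion carries the normals on the face side to each other, so a point close to the midpoint
    of edge [0] serves. *)
Lemma matches_face_meet : exists2 z, face G z & face H (f z).
Proof.
have [k l _ _ _] := GH; have l0 := len_gt0 G 0.
have s1 : 0 < len G 0 / 2 < len G 0 by lra.
have s2 : 0 < len G 0 / 2 < len H 0 by rewrite -l.
have [t [hG hH]] := filter_ex (filterI (face_side s1) (face_side s2)).
eexists; first exact: hG.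
have -> : f (edge_point G 0 (len G 0 / 2) + t *: unitv (edge_heading G 0 (len G 0 / 2)
    + orient R (ccw G) * (pi / 2))) =
    edge_point H 0 (len G 0 / 2) + t *: unitv (edge_heading H 0 (len G 0 / 2)
    + orient R (ccw H) * (pi / 2)); last exact: hH.
rewrite -matches_edge_point /f /motion addrAC (linD _ _ (_ - _)) addrA; congr (_ + _).
rewrite linZ /edge_heading -k -!mulrA -!addrA -!mulrDr; by rewrite matches_dir.
Qed.

Lemma matches_face_sub : f @` face G `<=` face H.
Proof.
have [z Gz Hz] := matches_face_meet.
apply: (@connected_face_sub H _ (f z)) => //.
- apply: connected_continuous_connected; first exact: face_connected.
  exact/continuous_subspaceT/motion_continuous.
- move=> _ [y Gy <-]; rewrite face_frontier => -[i _]; rewrite -matches_edge.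
  move=> [y' ey' /(can_inj (motionK _ _ _ _)) e].
  by apply: (face_frontier0 Gy); rewrite face_frontier -e; exists i.
Qed.

End Matching.

Lemma matches_sym G H b psi p q : matches G H b psi p q ->
  matches H G b (- (orient R b * psi)) q p.
Proof.
move=> [k l o v h]; split=> [i|i||i|i].
- by rewrite k.
- by rewrite l.
- by rewrite -o mulrA orient_sqr mul1r.
- by rewrite -v motionK.
- have := linK b psi (unitv (heading G i)).
  by rewrite lin_unitv -h lin_unitv => <-.
Qed.

Lemma matches_face G H b psi p q : matches G H b psi p q ->
  motion b psi p q @` face G = face H.
Proof.
move=> GH; apply/seteqP; split; first exact: matches_face_sub.
move=> z Hz; have GH' := matches_sym GH.
exists (motion b (- (orient R b * psi)) q p z).
  by apply: (matches_face_sub GH'); exists z.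
have := motionK b (- (orient R b * psi)) q p z.
by rewrite mulrN opprK mulrA orient_sqr mul1r.
Qed.

Lemma matches_congruent G H b psi p q : matches G H b psi p q -> congruent G H.
Proof.
move=> GH; exists (motion b psi p q); split.
- exact: motion_isometry.
- exact: matches_face.
- by case: GH.
- exact: matches_edge.
Qed.

End RigidMotion.

(** * Aligning two 3-gons by curvatures or by vertices *)

Section Frames.
Variable R : realType.
Implicit Types (G H : trigon R) (i : 'I_3).

(** The boundary is traced edge by edge from its first vertex and heading, so agreement there
    propagates. *)
Lemma matches_frame G H b psi p q :
  curv G =1 curv H -> len G =1 len H ->
  orient R b * orient R (ccw G) = orient R (ccw H) ->
  motion b psi p q (vtx G 0) = vtx H 0 ->
  unitv (heading H 0) = unitv (orient R b * heading G 0 + psi) ->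
  matches G H b psi p q.
Proof.
move=> k l o v0 h0.
have half_eq i : half G i = half H i by rewrite /half k l.
have h i : unitv (heading H i) = unitv (orient R b * heading G i + psi).
  elim/I3_ind: i => // i IH; rewrite heading_step (unitv_shift _ IH).
  rewrite -[RHS]lin_unitv heading_step lin_unitv half_eq -o.
  by congr unitv; ring.
split=> // i; elim/I3_ind: i => // i IH; rewrite !vtx_step -IH /motion.
rewrite addrAC (linD _ _ (_ - _)) addrA linZ lin_unitv; congr (_ + _).
rewrite /side k l /chord_dir (unitv_shift _ (h i)) half_eq -o.
by congr (_ *: unitv _); ring.
Qed.

Lemma congruent_curv G H : curv G =1 curv H -> congruent G H.
Proof.
move=> k; have sh := side_half_curv k.
(* The motion reflects exactly when the senses differ, and takes vertex and heading [0] of [G] to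
   those of [H]. *)
apply: (@matches_congruent _ G H (ccw G == ccw H)
  (heading H 0 - orient R (ccw G == ccw H) * heading G 0) (vtx G 0) (vtx H 0)).
apply: matches_frame => //.
- by move=> i; have [d th] := sh i; exact: len_half.
- by case: (ccw G); case: (ccw H); rewrite /orient /=; ring.
- by rewrite /motion subrr /lin /= !mul0r !mulr0 !mul0r subrr add0r addr0.
- by rewrite addrC subrK.
Qed.

Lemma motion_id : motion true 0 (0 : R * R) 0 = id.
Proof.
apply/funext => -[x y]; rewrite /motion subr0 add0r /lin /orient /= cos0 sin0.
by congr pair; ring.
Qed.

Lemma dotp_unitv (a b : R) : dotp (unitv a) (unitv b) = cos (a - b).
Proof. by rewrite cosD cosN sinN /dotp /unitv /=; ring. Qed.

Lemma dotpZl (t : R) u v : dotp (t *: u) v = t * dotp u v.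
Proof. by case: u v => [a b] [c d]; rewrite /dotp /=; rewrite /GRing.scale /=; ring. Qed.

Lemma dotpDl u v w : dotp (u + v) w = dotp u w + dotp v w :> R.
Proof. by rewrite /dotp /=; ring. Qed.

Lemma dotpC u v : dotp u v = dotp v u :> R.
Proof. by rewrite /dotp /=; ring. Qed.

Lemma vtxB G i : vtx G (i + 1) - vtx G i = side G i *: unitv (chord_dir G i).
Proof. by rewrite vtx_step addrAC subrr add0r. Qed.

Lemma side_vtx G i :
  side G i = Num.sqrt (dotp (vtx G (i + 1) - vtx G i) (vtx G (i + 1) - vtx G i)).
Proof.
rewrite vtxB dotpZl dotpC dotpZl dotp_unitv subrr cos0 mulr1 sqrtr_sqr.
by rewrite gtr0_norm ?side_gt0.
Qed.

Section SameVertices.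
Variables (G H : trigon R).
Hypothesis v : vtx H =1 vtx G.

Lemma same_side i : side H i = side G i.
Proof. by rewrite !side_vtx !v. Qed.

Lemma same_chord_dir i : unitv (chord_dir H i) = unitv (chord_dir G i).
Proof.
have := vtxB G i; rewrite -!v vtxB same_side => /(congr1 (fun z => (side G i)^-1 *: z)).
by rewrite !scalerA mulVf ?scale1r // side_neq0.
Qed.

Lemma same_orient_alpha i :
  unitv (orient R (ccw H) * (alpha H i + alpha H (i + 1))) =
  unitv (orient R (ccw G) * (alpha G i + alpha G (i + 1))).
Proof.
have := same_chord_dir (i + 1); rewrite !chord_dir_step (unitv_shift _ (same_chord_dir i)).
move/(unitv_shift (- chord_dir G i)).
by rewrite ![chord_dir G i + _]addrC !addrK.
Qed.

Lemma same_trigon_ccw : ccw H = ccw G -> same_trigon G H.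
Proof.
move=> o.
(* The turn between the other two chords is visible from the vertices and equals, up to sense,
   [total - alpha i]. *)
have al i : unitv (alpha H i) = unitv (alpha G i).
  have := same_orient_alpha (i + 1); rewrite o /unitv !cos_orient !sin_orient.
  rewrite !cos_alphaD !sin_alphaD !cos_totalN1 I3_addK => -[c s].
  have oo := orient_sqr R (ccw G); congr pair; first lra.
  have := congr1 ( *%R (orient R (ccw G))) s; rewrite !mulrA oo; lra.
have th i : half H i = half G i.
  apply: unitv_inj_itv; [exact: half_itv|exact: half_itv|].
  by have := unitv_shift (- (pi / 6)) (al i); rewrite /alpha !addrK.
have k : curv G =1 curv H.
  move=> i; apply: (mulIf (side_neq0 G i)).
  by rewrite curv_side -(same_side i) curv_side th.
have l : len G =1 len H by move=> i; exact: len_half (k i) (esym (same_side i)) (esym (th i)).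
have GH : matches G H true 0 0 0.
  apply: matches_frame => //; first by rewrite o /orient mul1r.
    by rewrite motion_id v.
  rewrite /orient mul1r addr0.
  have := unitv_shift (- (orient R (ccw G) * half G 0)) (same_chord_dir 0).
  by rewrite /chord_dir o th !addrK.
split=> // [|i]; first by rewrite -(matches_face GH) motion_id image_id.
by rewrite -(matches_edge GH) motion_id image_id.
Qed.

(** The sine of the turn from chord [0] to chord [1], fixed by the vertices, is [inv_diam] times a
    side with the sign of the sense of traversal. *)
Lemma ccw_inv_diam : 0 < inv_diam G -> 0 < inv_diam H -> ccw H = ccw G.
Proof.
move=> uG uH; have [_] := same_orient_alpha 0.
rewrite !sin_orient !sin_alphaD !cos_totalN1 !opprK !mul1r !sin_alpha.
have pG : 0 < inv_diam G * side G (0 + 1 + 1) by rewrite mulr_gt0 ?side_gt0.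
have pH : 0 < inv_diam H * side H (0 + 1 + 1) by rewrite mulr_gt0 ?side_gt0.
by case: (ccw G); case: (ccw H) => //; rewrite /orient; lra.
Qed.

End SameVertices.

(** Edge [i + 1] is opposite to vertex [i]. The [acos] remains because [alpha] may lie outside the
    interval from [0] to [pi]. *)
Lemma triangle_angle_vtx G i : triangle_angle (vtx G) i = acos (cos (alpha G (i + 1))).
Proof.
rewrite /triangle_angle /vector_angle I3_sub1; congr acos.
set k := i + 1 + 1; have ki : k + 1 = i by rewrite /k I3_addK.
rewrite -side_vtx vtxB; set w := vtx G k - vtx G i.
have {w}-> : w = - side G k *: unitv (chord_dir G k).
  by rewrite scaleNr -vtxB ki opprB.
have -> : Num.sqrt (dotp (- side G k *: unitv (chord_dir G k))
    (- side G k *: unitv (chord_dir G k))) = side G k.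
  rewrite dotpZl dotpC dotpZl dotp_unitv subrr cos0 mulr1 sqrtr_sqr normrN.
  by rewrite gtr0_norm ?side_gt0.
rewrite dotpZl dotpC dotpZl dotp_unitv.
have -> : cos (chord_dir G k - chord_dir G i) = - cos (alpha G (i + 1)).
  have := cos_alphaD G k; rewrite ki cos_totalN1 mulN1r.
  have := unitv_shift (- chord_dir G k) (chord_dir_step G k).
  rewrite [chord_dir G k + _]addrC addrK ki => -[+ _]; rewrite cos_orient => <-.
  by rewrite -cosN opprB.
by field; rewrite !side_neq0.
Qed.

End Frames.

(** * Excluding a face on the outer side of its boundary *)

Section Outside.
Variable R : realType.
Implicit Types (G : trigon R) (i j : 'I_3) (s t : R).

Lemma edge_point_shift G i s t : edge_point G i (s + t) =
  edge_point G i s + chord (curv G i) t *: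
    unitv (edge_heading G i s + orient R (ccw G) * (curv G i * t / 2)).
Proof.
rewrite /edge_point -cc_point_shift cc_pointE /edge_heading.
case: ccw; rewrite /orient ?mul1r // !mulN1r chordNl.
by congr (_ + _ *: unitv _); ring.
Qed.

Lemma is_derive_edge_height G i s (a : R) :
  is_derive s 1 (fun t => dotp (edge_point G i t) (unitv a))
    (cos (edge_heading G i s - a)).
Proof.
have [d1 d2] := cc_point_derive (vtx G i) (heading G i) (orient R (ccw G) * curv G i) s.
have -> : (fun t => dotp (edge_point G i t) (unitv a)) =
    cos a \*: (fun t => (edge_point G i t).1) + sin a \*: (fun t => (edge_point G i t).2).
  apply/funext => t.
  transitivity (cos a * (edge_point G i t).1 + sin a * (edge_point G i t).2) => //.
  by rewrite /dotp /unitv /=; ring.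
apply: is_derive_eq (is_deriveD (is_deriveZ _ d1) (is_deriveZ _ d2)) _.
rewrite /unitv /= -/(edge_heading G i s) cosD cosN sinN /GRing.scale /=.
by ring.
Qed.

Lemma edge_height_max G (a : R) : exists i, exists2 s, 0 <= s <= len G i &
  forall j t, 0 <= t <= len G j ->
    dotp (edge_point G j t) (unitv a) <= dotp (edge_point G i s) (unitv a).
Proof.
pose h j t := dotp (edge_point G j t) (unitv a).
have edge_max j : exists s, 0 <= s <= len G j /\
    forall t, 0 <= t <= len G j -> h j t <= h j s.
  have [|s] := @EVT_max R (h j) 0 (len G j) (ltW (len_gt0 G j)).
    apply: derivable_within_continuous => t _.
    by have [] := is_derive_edge_height G j t a.
  by rewrite in_itv /= => sj hs; exists s; split=> // t tj; apply: hs; rewrite in_itv.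
have [s hs] := fin_all_exists edge_max.
have [i _ hi] := arg_maxP (i0 := 0) (P := predT) (fun j => h j (s j)) isT.
exists i, (s i); first by have [] := hs i.
by move=> j t tj; apply: le_trans (hi j isT); have [_] := hs j; apply.
Qed.

(* Above its highest point the curve is missed by a vertical ray. *)
Lemma no_face_above G i s (a : R) : 0 < s < len G i ->
  (forall j t, 0 <= t <= len G j ->
    dotp (edge_point G j t) (unitv a) <= dotp (edge_point G i s) (unitv a)) ->
  unitv a <> unitv (edge_heading G i s + orient R (ccw G) * (pi / 2)).
Proof.
move=> si top ea; set P := edge_point G i s; set n := unitv a.
have nn : dotp n n = 1 by rewrite dotp_unitv subrr cos0.
have height t : dotp (P + t *: n) n = dotp P n + t by rewrite dotpDl dotpZl nn mulr1.
pose ray := [set P + t *: n | t in `]0, +oo[%classic].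
have ray_face : ray `<=` face G.
  have [t [t0 ft]] : exists t, 0 < t /\ face G (P + t *: n).
    have := face_side si; rewrite -ea => fs.
    have [t [t0 ft]] := filter_ex (filterI (nbhs_right_gt (0 : R)) fs).
    by exists t.
  apply: (@connected_face_sub R G _ (P + t *: n)) => //.
  - apply: connected_continuous_connected; first exact/connected_intervalP/interval_is_interval.
    apply: continuous_subspaceT => x.
    apply: cvgD; first exact: cvg_cst.
    by apply: cvgZr_tmp; exact: cvg_id.
  - by exists t => //=; rewrite in_itv /= t0.
  - move=> _ [x /= x0 <-]; rewrite face_frontier => -[j _ [r /= rj e]].
    move: x0 rj; rewrite !in_itv /= andbT => x0 rj.
    by have := top j r rj; rewrite e height -/P -/n; lra.
have [M [_ hM]] := @face_bounded R G.
pose B := `|M| + 1.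
have MB : M < B by rewrite /B; have := ler_norm M; lra.
(* A point of sup norm at most [B] has height at most [2 * B]; this [t] exceeds it. *)
pose t := 2 * B + `|dotp P n| + 1.
have B0 : 0 < B by rewrite /B; have := normr_ge0 M; lra.
have t0 : 0 < t by rewrite /t; have := normr_ge0 (dotp P n); lra.
have far : face G (P + t *: n) by apply: ray_face; exists t => //=; rewrite in_itv /= t0.
have := hM B MB _ far; have := height t; move: (P + t *: n) => -[x y].
rewrite /dotp /n /unitv /= prod_normE /= ge_max => e /andP[xB yB].
have c1 : `|x * cos a| <= B by rewrite normrM -[B]mulr1 ler_pM // ler_norml cos_geN1 cos_le1.
have c2 : `|y * sin a| <= B by rewrite normrM -[B]mulr1 ler_pM // ler_norml sin_geN1 sin_le1.
move: e c1 c2; rewrite -/(dotp _ _) => e /ler_normlP[c1 c1'] /ler_normlP[c2 c2'].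
have := ler_norm (- dotp P n); rewrite normrN /t in e *; rewrite /dotp /n /unitv /= in e *.
by lra.
Qed.

(** Otherwise measure height across chord [0], towards its face side. The third vertex lies below
    this chord and edge [0] rises above it, so the highest point is interior to an edge. There the
    edge turns downwards and, its curvature being negative, away from the face, which contradicts
    [no_face_above]. *)
Lemma inv_diam_ge0 G : (forall i, curv G i < 0) -> 0 <= inv_diam G.
Proof.
move=> kn; rewrite leNgt; apply/negP => u0; have pi0 := pi_gt0 R.
set o := orient R (ccw G).
set a := chord_dir G 0 + o * (pi / 2); pose h z := dotp z (unitv a).
have [i [s /andP[s0 sl] top]] := edge_height_max G a.
have th0 : half G 0 < 0.
  by rewrite /half -mulrA pmulr_llt0 // divr_gt0 // len_gt0.
have hd0 : dotp (unitv (chord_dir G 0)) (unitv a) = 0.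
  rewrite dotp_unitv /a opprD addrA subrr add0r cosN cos_orient.
  exact: cos_pihalf.
have h1 : h (vtx G 1) = h (vtx G 0).
  by have := vtx_step G 0; rewrite add0r => ->; rewrite /h dotpDl dotpZl hd0 mulr0 addr0.
have h2 : h (vtx G (1 + 1)) < h (vtx G 0).
  rewrite -h1 vtx_step /h dotpDl dotpZl gtrDl pmulr_rlt0 ?side_gt0 //.
  have := chord_dir_step G 0; rewrite add0r => ->; rewrite dotp_unitv /a.
  rewrite (_ : _ - _ = o * (alpha G 0 + alpha G 1 - pi / 2)); last by rewrite /o; ring.
  rewrite cos_orient cosBpihalf; have := sin_alphaD G 0; rewrite add0r => ->.
  by rewrite cos_totalN1 opprK mul1r sin_alpha nmulr_rlt0 // side_gt0.
have mid : h (vtx G 0) < h (edge_point G i s).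
  have l0 := len_gt0 G 0.
  have := top 0 (len G 0 / 2) ltac:(lra).
  rewrite -/(h _) -/(h _); apply: lt_le_trans.
  rewrite edge_pointE /h dotpDl ltrDl dotpZl dotp_unitv pmulr_rgt0.
    rewrite (_ : _ - _ = o * - (half G 0 / 2 + pi / 2)); last first.
      by rewrite /a /chord_dir /half -/o; field.
    rewrite cos_orient cosN cosDpihalf -sinN; apply: sin_gt0_pi.
    by have := half_itv G 0; lra.
  apply: chord_gt0; first lra.
  by have := edge_turn_lt G 0; have := normr_ge0 (curv G 0); nra.
have low j : h (vtx G j) < h (edge_point G i s).
  by elim/I3_case: j => //; [rewrite h1|exact: lt_trans h2 mid].
have s_gt0 : 0 < s.
  by rewrite lt_neqAle s0 andbT; apply/eqP => e; have := low i; rewrite -e edge_point0 ltxx.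
have s_lt : s < len G i.
  rewrite lt_neqAle sl andbT; apply/eqP => e; have := low (i + 1).
  by rewrite -edge_end -e ltxx.
have si : 0 < s < len G i by rewrite s_gt0.
apply: (no_face_above si top).
set e := edge_heading G i s.
have ce : cos (e - a) = 0.
  have d0 := is_derive_edge_height G i s a.
  have dm : is_derive s 1 (fun t => dotp (edge_point G i t) (unitv a)) 0.
    apply: (@derive1_at_max R _ 0 (len G i)); first exact/ltW/len_gt0.
    - by move=> t _; have [] := is_derive_edge_height G i t a.
    - by rewrite in_itv.
    - by move=> t; rewrite in_itv /= => /andP[t0 tl]; apply: top; rewrite !ltW.
  by rewrite -(@derive_val _ _ _ _ _ _ _ d0) (@derive_val _ _ _ _ _ _ _ dm).
(* A horizontal tangent leaves two headings; one is selected because the rest of the edge ends no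
   higher. *)
have se : o * sin (e - a) < 0.
  pose r := len G i - s.
  have := top i (s + r) ltac:(rewrite /r; lra).
  rewrite edge_point_shift dotpDl gerDl dotpZl dotp_unitv -/e -/o.
  have kr : `|curv G i| * r < 2 * pi.
    by have := edge_turn_lt G i; have := normr_ge0 (curv G i); rewrite /r; nra.
  have r0 : 0 < r by rewrite /r; lra.
  rewrite pmulr_rle0; last exact: chord_gt0.
  rewrite addrAC cosD ce mul0r add0r sin_orient.
  have sk : 0 < - sin (curv G i * r / 2).
    rewrite ltr0_norm in kr => //.
    rewrite -sinN; apply: sin_gt0_pi; have := kn i; nra.
  have := cos2Dsin2 (e - a); rewrite ce => c2.
  have oo := orient_sqr R (ccw G); rewrite -/o in oo *.
  move=> le; have {}le : o * sin (e - a) * - sin (curv G i * r / 2) <= 0 by lra.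
  rewrite lt_neqAle -(pmulr_lle0 _ sk) le andbT; apply/eqP => z.
  have : (o * sin (e - a)) ^+ 2 = 1 by rewrite exprMn expr2 oo mul1r; lra.
  by rewrite z; lra.
have so : sin (e - a) = - o.
  have := cos2Dsin2 (e - a); rewrite ce => c2.
  have oo := orient_sqr R (ccw G); rewrite -/o in oo.
  have : (o * sin (e - a)) ^+ 2 = 1 by rewrite exprMn expr2 oo mul1r; lra.
  move/eqP; rewrite sqrf_eq1 => /orP[] /eqP z; first lra.
  have := congr1 ( *%R o) z; rewrite mulrA oo; lra.
have : unitv (a - e) = unitv (o * (pi / 2)).
  rewrite /unitv cos_orient sin_orient cos_pihalf sin_pihalf mulr1.
  by rewrite -[a - e]opprB cosN sinN ce so opprK.
by move/(unitv_shift e); rewrite subrK [_ + e]addrC.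
Qed.

Lemma inv_diam_gt0 G :
  (forall i, triangle_angle (vtx G) i <= 5 * pi / 6) -> 0 < inv_diam G.
Proof.
move=> angle_le; rewrite ltNge; apply/negP => u0; have pi0 := pi_gt0 R.
have sn i : sin (alpha G i) <= 0.
  by rewrite sin_alpha mulr_le0_ge0 // ltW // side_gt0.
have bnd i : - (5 * pi / 6) < alpha G i < 7 * pi / 6.
  by have := half_itv G i; rewrite /alpha; lra.
(* Between [pi] and [7 * pi / 6] the triangle angle is [2 * pi - alpha], above [5 * pi / 6]; hence
   the threshold. *)
have lt_pi i : alpha G i < pi.
  rewrite ltNge; apply/negP => big.
  have := angle_le (i - 1); rewrite triangle_angle_vtx subrK.
  have -> : cos (alpha G i) = cos (pi *+ 2 - alpha G i).
    by rewrite addrC cosD2pi cosN.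
  rewrite cosK; last by rewrite in_itv /=; have := bnd i; lra.
  by have := bnd i; lra.
have le0 i : alpha G i <= 0.
  rewrite leNgt; apply/negP => p; have := sn i.
  have : 0 < sin (alpha G i) by apply: sin_gt0_pi; rewrite p lt_pi.
  by lra.
(* If it vanished, all [alpha] would be [0], against the odd multiple of [pi]. *)
have un0 : inv_diam G != 0.
  apply/eqP => z; have a0 i : alpha G i = 0.
    apply: sin_eq0_itv; last by rewrite sin_alpha z mul0r.
    by have := bnd i; have := le0 i; lra.
  have := cos_totalN1 G; rewrite /total !a0 !addr0 cos0; lra.
have kn i : curv G i < 0.
  have : curv G i * side G i < 0.
    rewrite curv_side pmulr_rlt0 // -oppr_gt0 -sinN; apply: sin_gt0_pi.
    by have := half_itv G i; have := le0 i; rewrite /alpha; lra.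
  by rewrite pmulr_llt0 // side_gt0.
have := inv_diam_ge0 kn; move=> u1; move: un0.
by rewrite eq_le u0 u1.
Qed.

End Outside.

Theorem lemma3p2 (R : realType) (kappa : 'I_3 -> R) (G : trigon R)
    (hG : curv G =1 kappa) :
  (forall H : trigon R, curv H =1 kappa -> congruent G H) /\
  (forall H : trigon R, vtx H =1 vtx G ->
     ccw H = ccw G \/
     (forall i, triangle_angle (vtx G) i <= 5 * pi / 6) ->
     same_trigon G H).
Proof.
split=> [H hH|H v [same_ccw|angle_le]].
- by apply: congruent_curv => i; rewrite hG hH.
- exact: same_trigon_ccw.
- apply: same_trigon_ccw => //; apply: ccw_inv_diam => //.
    exact: inv_diam_gt0.
  by apply: inv_diam_gt0 => i; rewrite /triangle_angle !v; exact: angle_le.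
Qed.
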